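(* There is an absolute constant $A>0$ such that the following holds. Let $T$ be a finite set of distinct positive integers with minimum element $N\ge3$. Let $\alpha=\prod_{n\in T}(1-1/n)$ be the common value of $\alpha(C)$ for $C\in\mathcal{C}(T)$. Then \[ \frac1{W(T)}\sum_{C\in\mathcal{C}(T)}|\delta(C)-\alpha|^2\le A\,\frac{\alpha^2\log N}{N^2}. \]
   Context: For a finite set $T$ of positive integers, $\mathcal{C}(T)$ is the set of all $C=\{(n,r(n)):n\in T\}$ with exactly one integer $r(n)$, $1\le r(n)\le n$, chosen for each $n\in T$; each pair $(n,r)$ is interpreted as the residue class $r\pmod n$. $W(T)=\#\mathcal{C}(T)=\prod_{n\in T}n$. For $C\in\mathcal{C}(T)$, $\delta(C)$ is the asymptotic density of the set of integers not congruent to $r\pmod n$ for any $(n,r)\in C$, and $\alpha(C)=\prod_{n\in T}(1-1/n)$. *)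

(* Defs.v *)
From HB Require Import structures.
From mathcomp Require Import all_boot all_order all_algebra.
From mathcomp Require Import finmap.
From mathcomp Require Import all_classical all_reals all_analysis.
Set Implicit Arguments.
Unset Strict Implicit.
Unset Printing Implicit Defensive.
Import Order.TTheory GRing.Theory Num.Theory.
Import numFieldNormedType.Exports.
Local Open Scope ring_scope.
Local Open Scope classical_set_scope.
Local Open Scope fset_scope.

(* Since ['I_n] is {0, ..., n-1}, the shifted value [(r n).+1] runs over
   {1, ..., n}. *)
Definition choice_graph (T : {fset nat})
    (r : {dffun forall n : T, 'I_(val n)}) : {fset nat * nat} :=
  [fset (val n, (r n).+1) | n : T].

Definition systems (T : {fset nat}) : {fset {fset nat * nat}} :=
  [fset choice_graph r | r : {dffun forall n : T, 'I_(val n)}].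

Definition W (T : {fset nat}) : nat := #|` systems T|.

Definition uncovered (C : {fset nat * nat}) : set int :=
  [set m : int | forall n r : nat, (n, r) \in C -> ~ (m = r %[mod n])%Z].

Definition count_upto (S : set int) (x : nat) : nat :=
  #|` fset_set (S `&` [set m : int | `|m| <= x%:Z])|.

(* [limn] is total; the limit exists in particular for every periodic [S],
   such as [uncovered C] when all moduli of [C] are positive. *)
Definition asymptotic_density (R : realType) (S : set int) : R :=
  limn (fun x : nat => (count_upto S x)%:R / (x.*2.+1)%:R : R).

Definition delta (R : realType) (C : {fset nat * nat}) : R :=
  asymptotic_density R (uncovered C).

Definition alpha (R : realType) (T : {fset nat}) : R :=
  \prod_(n <- T) (1 - n%:R^-1).

(* Main.v *)
Require Import Defs.
From HB Require Import structures.
From mathcomp Require Import all_boot all_order all_algebra.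
From mathcomp Require Import finmap.
From mathcomp Require Import all_classical all_reals all_analysis.
From mathcomp Require Import zify ring lra.
Set Implicit Arguments.
Unset Strict Implicit.
Unset Printing Implicit Defensive.
Import Order.TTheory GRing.Theory Num.Theory.
Import numFieldNormedType.Exports.
Local Open Scope ring_scope.

(* With L a common multiple of T, [delta C] is the proportion of m < L left
   uncovered by C.  Averaging over C, the mean of [delta] is alpha, and its second
   moment is the average over m < L (m being the difference of two integers) of
   prod_(n in T) (n - 2 + [n | m]) / n, that is
     alpha^2 * prod_n (1 - 1/(n-1)^2) * avg_m prod_(n | m) (1 + 1/(n-2)).
   The last product is at most exp (g m), where g m = sum_(n in T, n | m) 1/(n-2),
   and exp x <= 1 + x + 2 x^2 + 2 x^4 exp x.  The linear term is cancelled by the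
   factor prod (1 - 1/(n-1)^2), up to avg g^2.  Then
   avg g^2 << sum_(n, k in T) gcd (n, k) / (n k)^2 << log N / N^2, while g is at most
   3 N^(-1/2) times h m = sum_(d | gcd (m, L)) d^(-1/2), and exp g << h^6; hence
   g^4 exp g << h^10 / N^2, and all moments of h are bounded independently of L. *)

(** * Densities and moments over the choice of residues *)

(** Moving the window by one loses [f s] and gains [f (s + L)], which are equal; induction on [s] in
    both directions does the rest. *)
Lemma sum_periodic_shift (V : zmodType) (L : nat) (f : int -> V) :
  (forall z, f (z + L%:Z) = f z) ->
  forall s : int, \sum_(i < L) f (s + i%:Z) = \sum_(i < L) f i%:Z.
Proof.
move=> fL.
have step s : \sum_(i < L) f (s + 1 + i%:Z) = \sum_(i < L) f (s + i%:Z).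
  have : \sum_(i < L.+1) f (s + i%:Z) = _ := big_ord_recl _ _.
  rewrite big_ord_recr /= fL addr0 addrC => /addrI ->.
  by apply: eq_bigr => i _; rewrite -addrA -PoszD.
move=> s; elim/int_ind: s => [|n IH|n IH].
- by apply: eq_bigr => i _; congr f; lia.
- by rewrite -IH -[RHS]step; apply: eq_bigr => i _; congr f; lia.
- by rewrite -IH -step; apply: eq_bigr => i _; congr f; lia.
Qed.

Lemma sum_periodic_mul (V : zmodType) (L q : nat) (f : int -> V) (s : int) :
  (forall z, f (z + L%:Z) = f z) ->
  \sum_(i < q * L) f (s + i%:Z) = (\sum_(i < L) f i%:Z) *+ q.
Proof.
move=> fL; elim: q s => [|q IH] s; first by rewrite mul0n big_ord0.
rewrite mulSn big_split_ord /= sum_periodic_shift // mulrS; congr (_ + _).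
by rewrite -(IH (s + L%:Z)); apply: eq_bigr => i _; rewrite PoszD addrA.
Qed.

(** Write [M = q * L + r] with [r < L]. The full periods agree exactly with the mean, and both the
    remaining sum and [r] times the mean lie between 0 and [r]. *)
Lemma sum_periodic_approx (R : realFieldType) (L : nat) (f : int -> R)
    (s : int) (M : nat) :
  (0 < L)%N -> (forall z, f (z + L%:Z) = f z) -> (forall z, 0 <= f z <= 1) ->
  `|\sum_(i < M) f (s + i%:Z) - M%:R * (L%:R^-1 * \sum_(i < L) f i%:Z)| <= L%:R.
Proof.
move=> L0 fL f01.
have sum01 K t : 0 <= \sum_(i < K) f (t + i%:Z) <= K%:R.
  rewrite sumr_ge0 => [|i _]; last by case/andP: (f01 (t + i%:Z)).
  rewrite -[K in X in _ <= X]card_ord -sumr_const; apply: ler_sum => i _.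
  by case/andP: (f01 (t + i%:Z)).
set c := \sum_(i < L) _.
have L0' : 0 < L%:R :> R by rewrite ltr0n.
have /andP[c0 cL] : 0 <= c <= L%:R.
  by rewrite /c -(sum_periodic_shift fL 0) sum01.
have [q [r [ltrL ->]]] : exists q r, (r < L)%N /\ M = (q * L + r)%N.
  by exists (M %/ L)%N, (M %% L)%N; rewrite ltn_mod -divn_eq.
rewrite big_split_ord /= sum_periodic_mul // -/c.
under eq_bigr => i _ do rewrite PoszD addrA.
have := sum01 r (s + (q * L)%N%:Z); set e := \sum_(i < r) _ => /andP[e0 er].
rewrite natrD natrM mulrDl.
have -> : q%:R * L%:R * (L%:R^-1 * c) = c *+ q.
  by rewrite -mulr_natl; field; rewrite gt_eqF.
have rL : r%:R <= L%:R :> R by rewrite ler_nat ltnW.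
have k1 : L%:R^-1 * c <= 1 by rewrite mulrC ler_pdivrMr // mul1r.
have k0 : 0 <= L%:R^-1 * c by rewrite mulr_ge0 // invr_ge0 ltW.
have r0 : 0 <= r%:R :> R by [].
have p1 : r%:R * (L%:R^-1 * c) <= r%:R by rewrite ler_piMr.
have p0 : 0 <= r%:R * (L%:R^-1 * c) by rewrite mulr_ge0.
by rewrite opprD addrACA subrr add0r ler_norml; apply/andP; split; lra.
Qed.

Lemma count_upto_sum (R : realType) (b : int -> bool) (x : nat) :
  (count_upto [set m | b m]%classic x)%:R
    = \sum_(i < x.*2.+1) (b (- x%:Z + i%:Z))%:R :> R.
Proof.
rewrite /count_upto; set S := (_ `&` _)%classic.
(* The interval from [- x] to [x] is enumerated as [- x + i] with [i < 2 x + 1]. *)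
pose s := [seq z <- [seq - x%:Z + i%:Z | i <- iota 0 x.*2.+1] | b z].
have Ss : S = [set` [fset z in s]%fset]%classic.
  apply/seteqP; split => z /=.
    move=> [/= bz zx]; rewrite in_fset mem_filter bz andTb.
    apply/mapP; exists (absz (z + x%:Z)); last by lia.
    by rewrite mem_iota; lia.
  rewrite in_fset mem_filter => /andP[bz /mapP[i]].
  by rewrite mem_iota => ix zE; split=> //=; rewrite zE; lia.
rewrite Ss set_fsetK card_fseq undup_id; last first.
  by rewrite filter_uniq // map_inj_uniq ?iota_uniq // => i j; lia.
rewrite size_filter count_map -sum1_count natr_sum big_mkcond.
rewrite -[iota _ _]/(index_iota 0 x.*2.+1) big_mkord.
by apply: eq_bigr => i _ /=; case: (b _).
Qed.

Lemma asymptotic_density_periodic (R : realType) (L : nat) (b : int -> bool) :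
  (0 < L)%N -> (forall z, b (z + L%:Z) = b z) ->
  asymptotic_density R [set m | b m]%classic
    = L%:R^-1 * \sum_(i < L) (b i%:Z)%:R.
Proof.
move=> L0 bL; set rho := RHS.
apply/cvg_lim => //.
apply/cvgrPdist_le => e e0.
near=> x.
rewrite count_upto_sum.
have M0 : 0 < x.*2.+1%:R :> R by rewrite ltr0n.
set S := \sum_(i < _) _; set M : R := _%:R.
have -> : rho - S / M = - ((S - M * rho) / M) by field; rewrite gt_eqF.
rewrite normrN normrM normfV (gtr0_norm M0) ler_pdivrMr //.
have := @sum_periodic_approx R L (fun z => (b z)%:R) (- x%:Z) x.*2.+1 L0.
rewrite -/rho => /(_ _ _)/le_trans; apply.
- by move=> z; rewrite bL.
- by move=> z; case: (b z); rewrite ?lexx ler01.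
(* The error is at most [L / (2 x + 1)], so [x >= L / e] suffices. *)
rewrite mulrC -ler_pdivrMr // {}/M.
apply: (@le_trans _ _ x%:R); last by rewrite ler_nat; lia.
near: x; exact: nbhs_infty_ger.
Unshelve. all: by end_near. Qed.

(** A boolean form of membership in [uncovered], so that it can be summed as an indicator. *)
Definition avoids (T : {fset nat}) (r : {dffun forall n : T, 'I_(val n)})
    (z : int) : bool :=
  [forall n : T, (z != (r n).+1 %[mod val n])%Z].

Lemma uncovered_choice_graph (T : {fset nat})
    (r : {dffun forall n : T, 'I_(val n)}) :
  uncovered (choice_graph r) = [set z | avoids r z]%classic.
Proof.
apply/seteqP; split => z /=.
  move=> unc; apply/forallP => n; apply/negP => /eqP zE.
  by apply: (unc (val n) (r n).+1 _ zE); apply/imfsetP; exists n.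
move/forallP => av n k /imfsetP[m _ [-> ->]] zE.
by have := av m; rewrite zE eqxx.
Qed.

Lemma delta_choice_graph (R : realType) (T : {fset nat})
    (r : {dffun forall n : T, 'I_(val n)}) (L : nat) :
  (0 < L)%N -> (forall n, n \in T -> (n %| L)%N) ->
  delta R (choice_graph r) = L%:R^-1 * \sum_(i < L) (avoids r i%:Z)%:R.
Proof.
move=> L0 TL; rewrite /delta uncovered_choice_graph.
apply: asymptotic_density_periodic => // z.
apply: eq_forallb => n; congr (~~ _); congr (_ == _).
have /dvdnP[q ->] := TL _ (valP n).
by rewrite PoszM addrC modzMDl.
Qed.

Lemma choice_graph_inj (T : {fset nat}) : injective (@choice_graph T).
Proof.
move=> r r' eq_rr'; apply/ffunP => n; apply: val_inj.
have : (val n, (r n).+1) \in choice_graph r by apply/imfsetP; exists n.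
rewrite eq_rr' => /imfsetP[m _ []] /val_inj -> [E].
exact: E.
Qed.

Lemma sum_systems (V : nmodType) (T : {fset nat}) (F : {fset nat * nat} -> V) :
  \sum_(C <- systems T) F C
    = \sum_(r : {dffun forall n : T, 'I_(val n)}) F (choice_graph r).
Proof.
rewrite /systems big_imfset /=; last by move=> r r' _ _; apply: choice_graph_inj.
by rewrite big_enum.
Qed.

(** This is the independence of the residues: conditions imposed modulus by modulus cut out a
    product set of choice functions. *)
Lemma prod_dffun_pred (T : {fset nat}) (P : forall n : T, pred 'I_(val n)) :
  (\sum_(r : {dffun forall n : T, 'I_(val n)}) [forall n, P n (r n)])%N
    = (\prod_(n : T) #|P n|)%N.
Proof.
have := card_family P; rewrite foldrE big_image => <-.
rewrite -sum1_card [RHS]big_mkcond /=.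
by apply: eq_bigr => r _; rewrite -[r \in _]/[forall n, _]; case: [forall n, _].
Qed.

Lemma W_prod (T : {fset nat}) : W T = (\prod_(n <- T) n)%N.
Proof.
rewrite /W /systems card_imfset /=; last exact: choice_graph_inj.
rewrite -cardE card_dep_ffun foldrE big_image big_seq_fsetE /=.
by apply: eq_bigr => n _; rewrite card_ord.
Qed.

Lemma residue_ord (n : nat) (z : int) : (0 < n)%N ->
  exists j : 'I_n, forall i : 'I_n, (z == i.+1 %[mod n])%Z = (i == j).
Proof.
move=> n0.
(* The ordinal [i] stands for the residue [i + 1], hence the shift of [z] by one. *)
have jn : (absz ((z - 1) %% n)%Z < n)%N by lia.
exists (Ordinal jn) => i; rewrite -val_eqE /=.
have -> : (z == i.+1 %[mod n])%Z = ((z - 1) == i %[mod n])%Z.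
  by rewrite !eqz_mod_dvd; congr (_ %| _)%Z; lia.
rewrite [X in _ == X]modz_small; last by have := ltn_ord i; lia.
have := modz_ge0 (z - 1) (_ : n%:Z != 0); lia.
Qed.

Lemma card_avoid1 (n : nat) (z : int) : (0 < n)%N ->
  #|[pred i : 'I_n | z != i.+1 %[mod n]]%Z| = n.-1.
Proof.
move=> n0; have [j jE] := residue_ord z n0.
transitivity #|predC1 j|; last by rewrite cardC1 card_ord.
by apply: eq_card => i; rewrite !inE jE.
Qed.

(** The two forbidden residues coincide exactly when [n] divides [w - z]; this gives back one
    choice. *)
Lemma card_avoid2 (n : nat) (z w : int) : (1 < n)%N ->
  #|[pred i : 'I_n | (z != i.+1 %[mod n]) && (w != i.+1 %[mod n])]%Z|
    = (n - 2 + (n %| (w - z)%R)%Z)%N.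
Proof.
move=> n1; have n0 := ltnW n1.
have [j jE] := residue_ord z n0; have [k kE] := residue_ord w n0.
have -> : (n %| w - z)%Z = (k == j).
  rewrite -eqz_mod_dvd -jE eq_sym.
  by have /eqP-> : (w == k.+1 %[mod n])%Z by rewrite kE.
have -> : #|[pred i : 'I_n | (z != i.+1 %[mod n]) && (w != i.+1 %[mod n])]%Z|
    = #|[predC pred2 j k]|.
  by apply: eq_card => i; rewrite !inE negb_or jE kE.
have := cardC (pred2 j k); rewrite card2 card_ord eq_sym.
move: #|_| => c.
by case: (k == j) => /= E; lia.
Qed.

Lemma prod_common_multiple (s : seq nat) :
  (forall n, n \in s -> (0 < n)%N) ->
  (0 < \prod_(n <- s) n)%N /\ forall n, n \in s -> (n %| \prod_(n <- s) n)%N.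
Proof.
move=> s0; split; first by rewrite big_seq prodn_cond_gt0.
by move=> n ns; rewrite (big_rem n) //= dvdn_mulr.
Qed.

Lemma sum_avoids (R : realType) (T : {fset nat}) (z : int) :
  (forall n, n \in T -> (1 < n)%N) ->
  (W T)%:R^-1 * \sum_(r : {dffun forall n : T, 'I_(val n)}) (avoids r z)%:R
    = alpha R T.
Proof.
move=> T1.
have := prod_dffun_pred (fun n : T => [pred i : 'I_(val n) | z != i.+1 %[mod val n]]%Z).
move=> /(congr1 (fun k => k%:R : R)); rewrite natr_sum => ->.
rewrite W_prod /alpha !big_seq_fsetE !natr_prod -prodfV -big_split /=.
apply: eq_bigr => n _; have n1 := T1 _ (valP n).
rewrite card_avoid1 ?(ltnW n1) // -subn1 natrB ?(ltnW n1) //.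
by rewrite mulrBr mulVf ?mulr1 // pnatr_eq0 -lt0n ltnW.
Qed.

Lemma sum_avoids2 (R : realType) (T : {fset nat}) (z w : int) :
  (forall n, n \in T -> (1 < n)%N) ->
  (W T)%:R^-1 * \sum_(r : {dffun forall n : T, 'I_(val n)})
      (avoids r z)%:R * (avoids r w)%:R
    = \prod_(n <- T) ((n - 2 + (n %| (w - z)%R)%Z)%:R / n%:R) :> R.
Proof.
move=> T1.
have := prod_dffun_pred (fun n : T => [pred i : 'I_(val n) |
  (z != i.+1 %[mod val n]) && (w != i.+1 %[mod val n])]%Z).
move=> /(congr1 (fun k => k%:R : R)); rewrite natr_sum => E.
rewrite (eq_bigr (fun r : {dffun forall n : T, 'I_(val n)} =>
  [forall n, [pred i : 'I_(val n) |
  (z != i.+1 %[mod val n]) && (w != i.+1 %[mod val n])]%Z (r n)]%:R)); last first.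
  move=> r _; rewrite -natrM mulnb; congr (nat_of_bool _)%:R.
  apply/andP/forallP => [[/forallP zr /forallP wr] n|zw] /=.
    by rewrite zr wr.
  by split; apply/forallP => n; have /andP[] := zw n.
rewrite E W_prod !big_seq_fsetE !natr_prod -prodfV -big_split /=.
apply: eq_bigr => n _; have n1 := T1 _ (valP n).
by rewrite card_avoid2 // mulrC.
Qed.

Lemma mean_delta (R : realType) (T : {fset nat}) :
  (forall n, n \in T -> (1 < n)%N) ->
  (W T)%:R^-1 * \sum_(C <- systems T) delta R C = alpha R T.
Proof.
move=> T1; set L := (\prod_(n <- T) n)%N.
have [L0 TL] : (0 < L)%N /\ forall n, n \in T -> (n %| L)%N.
  by apply: prod_common_multiple => n /T1/ltnW.
rewrite sum_systems (eq_bigr _ (fun r _ => delta_choice_graph R r L0 TL)).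
rewrite -mulr_sumr exchange_big /= mulrCA mulr_sumr.
under eq_bigr => i _ do rewrite sum_avoids //.
by rewrite sumr_const card_ord -[X in _ * X]mulr_natl mulKf // pnatr_eq0 -lt0n.
Qed.

(** The square of [delta] is an average over pairs [i, j < L]. By [sum_avoids2] the mean of a pair
    depends only on [j - i], and periodicity in [j] removes the shift by [i], leaving a single
    average. *)
Lemma mean_delta_sqr (R : realType) (T : {fset nat}) (L : nat) :
  (forall n, n \in T -> (1 < n)%N) ->
  (0 < L)%N -> (forall n, n \in T -> (n %| L)%N) ->
  (W T)%:R^-1 * \sum_(C <- systems T) delta R C ^+ 2
    = L%:R^-1 * \sum_(m < L) \prod_(n <- T) ((n - 2 + (n %| m))%:R / n%:R).
Proof.
move=> T1 L0 TL.
pose G (z : int) : R := \prod_(n <- T) ((n - 2 + (n %| z)%Z)%:R / n%:R).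
have GL z : G (z + L%:Z) = G z.
  rewrite /G big_seq [RHS]big_seq; apply: eq_bigr => n nT.
  by rewrite rpredDr //; exact: TL.
have L0' : L%:R != 0 :> R by rewrite pnatr_eq0 -lt0n.
rewrite sum_systems.
under eq_bigr => r _.
  rewrite (delta_choice_graph R r L0 TL) exprMn [X in _ * X]expr2 mulr_suml.
  under [X in _ * X]eq_bigr => i _ do rewrite mulr_sumr.
  over.
rewrite -mulr_sumr exchange_big /= mulrCA mulr_sumr.
under [X in _ * X]eq_bigr => i _.
  rewrite exchange_big /= mulr_sumr.
  under eq_bigr => j _ do rewrite sum_avoids2 // addrC.
  rewrite (sum_periodic_shift GL (- i%:Z)) /G.
  over.
by rewrite sumr_const card_ord -[X in _ * X]mulr_natl expr2; field.
Qed.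

Lemma variance_delta (R : realType) (T : {fset nat}) (L : nat) :
  (forall n, n \in T -> (1 < n)%N) ->
  (0 < L)%N -> (forall n, n \in T -> (n %| L)%N) ->
  (W T)%:R^-1 * (\sum_(C <- systems T) `|delta R C - alpha R T| ^+ 2)
    = L%:R^-1 * (\sum_(m < L) \prod_(n <- T) ((n - 2 + (n %| m))%:R / n%:R))
      - alpha R T ^+ 2.
Proof.
move=> T1 L0 TL; rewrite -mean_delta_sqr //; set a := alpha R T.
have W0 : (W T)%:R != 0 :> R.
  rewrite pnatr_eq0 -lt0n W_prod.
  by have [] := @prod_common_multiple T (fun n nT => ltnW (T1 n nT)).
under eq_bigr => C _.
  rewrite real_normK ?num_real // sqrrB -mulrnAr mulrC.
  over.
rewrite !big_split /= sumrN -mulr_sumr mulrDr mulrBr mulrCA mean_delta //.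
rewrite big_const_seq count_predT -[size _]/(W T) iter_addr addr0.
by rewrite -/a -[a ^+ 2 *+ W T]mulr_natl mulKf //; ring.
Qed.

(** * The second moment of the divisor sum *)

(** Each selected entry of [s] uses up one occurrence in [t], and the terms of [t] left over are
    nonnegative. *)
Lemma ler_sum_subset (R : realDomainType) (I : eqType) (s t : seq I)
    (P : pred I) (F : I -> R) :
  uniq s -> {subset [seq i <- s | P i] <= t} -> (forall i, 0 <= F i) ->
  \sum_(i <- s | P i) F i <= \sum_(i <- t) F i.
Proof.
move=> us st F0; rewrite -big_filter.
move: (filter_uniq P us) st; move: [seq i <- s | P i] => {us}s us.
elim: s us t => [|x s IH] /=; first by move=> _ t _; rewrite big_nil sumr_ge0.
move=> /andP[xs us] t st; have xt : x \in t by apply: st; rewrite mem_head.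
rewrite big_cons (big_rem x xt) /= lerD2l; apply: IH => // y ys.
have := st y; rewrite inE ys orbT (perm_mem (perm_to_rem xt)) inE => /(_ isT).
by case: eqVneq => // yx; rewrite -yx ys in xs.
Qed.

Lemma avg_dvd (R : realType) (d L : nat) : (0 < L)%N -> (d %| L)%N ->
  L%:R^-1 * \sum_(m < L) (d %| m)%:R = d%:R^-1 :> R.
Proof.
move=> L0 /dvdnP[q LE]; move: L0; rewrite {}LE muln_gt0 => /andP[q0 d0].
pose f (z : int) : R := (d %| z)%Z%:R.
have fd z : f (z + d%:Z) = f z by rewrite /f rpredDr // dvdzz.
have := sum_periodic_mul q 0 fd.
rewrite (eq_bigr (fun m : 'I_(q * d) => (d %| m)%:R)) => [->|i _]; last first.
  by rewrite add0r.
(* Each period of length [d] contains one multiple of [d], namely 0. *)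
have -> : \sum_(i < d) f i%:Z = 1.
  rewrite (bigD1 (Ordinal d0)) //= /f dvdz0 big1 ?addr0 // => i i0.
  apply/eqP; rewrite pnatr_eq0 eqb0; apply: contraNN i0 => di.
  rewrite -val_eqE /= -leqn0 leqNgt; apply/negP => i_gt0.
  by have := dvdn_leq i_gt0 di; rewrite leqNgt ltn_ord.
by rewrite natrM; field; rewrite !pnatr_eq0 -!lt0n q0 d0.
Qed.

Lemma avg_dvd_sum (R : realType) (s : seq nat) (a : nat -> R) (L : nat) :
  (0 < L)%N -> (forall n, n \in s -> (n %| L)%N) ->
  L%:R^-1 * \sum_(m < L) \sum_(n <- s) a n * (n %| m)%:R
    = \sum_(n <- s) a n / n%:R.
Proof.
move=> L0 sL; rewrite exchange_big /= mulr_sumr big_seq [RHS]big_seq.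
apply: eq_bigr => n ns.
by rewrite -mulr_sumr mulrCA avg_dvd // sL.
Qed.

(** Both [n] and [k] divide [m] exactly when their lcm does, an event of frequency
    [1 / lcmn n k]. *)
Lemma avg_dvd_sum_sqr (R : realType) (s : seq nat) (a : nat -> R) (L : nat) :
  (0 < L)%N -> (forall n, n \in s -> (n %| L)%N) ->
  L%:R^-1 * \sum_(m < L) (\sum_(n <- s) a n * (n %| m)%:R) ^+ 2
    = \sum_(n <- s) \sum_(k <- s) a n * a k / (lcmn n k)%:R.
Proof.
move=> L0 sL.
under eq_bigr => m _ do rewrite expr2 mulr_suml.
rewrite exchange_big /= mulr_sumr big_seq [RHS]big_seq.
apply: eq_bigr => n ns.
under eq_bigr => m _ do rewrite mulr_sumr.
rewrite exchange_big /= mulr_sumr big_seq [RHS]big_seq.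
apply: eq_bigr => k ks.
rewrite -(@avg_dvd R (lcmn n k) L) ?dvdn_lcm ?sL // [RHS]mulrCA; congr (_ * _).
by rewrite mulr_sumr; apply: eq_bigr => m _; rewrite dvdn_lcm -mulnb natrM; ring.
Qed.

Lemma sum_inv_sqr_le (R : realType) (J K : nat) : (0 < J)%N ->
  \sum_(J <= j < K) j%:R ^- 2 <= 2 / J%:R :> R.
Proof.
move=> J0; have [KJ|JK] := leqP K J; first by rewrite big_geq.
rewrite -(subnKC (ltnW JK)); move: (K - J)%N => k.
have J0' : 0 < J%:R :> R by rewrite ltr0n.
(* Telescoping: [x ^- 2 <= 2 / x - 2 / (x + 1)] for [x >= 1]. *)
suff : \sum_(J <= j < J + k) j%:R ^- 2 <= 2 / J%:R - 2 / (J + k)%:R :> R.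
  by move=> /le_trans; apply; rewrite gerBl divr_ge0.
elim: k => [|k IH]; first by rewrite addn0 big_geq // subrr.
rewrite addnS big_nat_recr ?leq_addr //=.
have jk0 : 1 <= (J + k)%:R :> R by rewrite ler1n addn_gt0 J0.
rewrite -[(J + k).+1%:R]natr1; move: IH jk0; set x := (J + k)%:R => IH x1.
have : x ^- 2 <= 2 / x - 2 / (x + 1); last by lra.
rewrite -subr_ge0.
have -> : 2 / x - 2 / (x + 1) - x ^- 2 = (x - 1) / (x ^+ 2 * (x + 1)).
  by field; rewrite !gt_eqF //; lra.
by rewrite divr_ge0 ?mulr_ge0 ?sqr_ge0 //; lra.
Qed.

(** By induction: the increment of [ln] from [N - 1] to [N] is [- ln (1 - 1 / N) >= 1 / N]. *)
Lemma harmonic_le_ln (R : realType) (N : nat) : (0 < N)%N ->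
  \sum_(1 <= d < N.+1) d%:R^-1 <= 1 + ln N%:R :> R.
Proof.
case: N => // N _; elim: N => [|N IH].
  by rewrite big_nat1 invr1 ln1 addr0.
rewrite big_nat_recr //=.
suff step : N.+2%:R^-1 <= ln N.+2%:R - ln N.+1%:R :> R.
  by apply: le_trans (lerD IH step) _; rewrite addrA addrAC addrK.
have N1 : 0 < N.+1%:R :> R by [].
have N2 : 0 < N.+2%:R :> R by [].
have x1 : N.+2%:R^-1 < 1 :> R by rewrite invf_lt1 // ltr1n.
have -> : ln N.+2%:R - ln N.+1%:R = - ln (1 + - N.+2%:R^-1) :> R.
  rewrite -[LHS]opprB -ln_div ?posrE //; congr (- ln _).
  by rewrite -[N.+1%:R](addrK 1) natr1 mulrBl divff ?mul1r // gt_eqF.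
by rewrite lerNr le_ln1Dx // ltrN2.
Qed.

(** A multiple [n = d * j] taken from [s] is at least [maxn N d], so the sum is [d ^- 2] times a
    tail of the series of inverse squares. *)
Lemma sum_inv_sqr_multiples (R : realType) (s : seq nat) (N d : nat) :
  uniq s -> (forall n, n \in s -> (N <= n)%N) -> (0 < N)%N -> (0 < d)%N ->
  \sum_(n <- s) (d %| n)%:R * n%:R ^- 2 <= 2 / (d%:R * (maxn N d)%:R) :> R.
Proof.
move=> us sN N0 d0; set M := maxn N d.
have d0' : 0 < d%:R :> R by rewrite ltr0n.
have M0 : 0 < M%:R :> R by rewrite ltr0n leq_max N0.
(* [J] is [M / d] rounded up, the least possible quotient [j]. *)
pose J := ((M + d.-1) %/ d)%N.
have MJ : (M <= J * d)%N.
  by have := divn_eq (M + d.-1) d; have := ltn_pmod (M + d.-1) d0; rewrite -/J; lia.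
have J0 : (0 < J)%N by rewrite lt0n; apply: contraTneq MJ => ->; lia.
have -> : \sum_(n <- s) (d %| n)%:R * n%:R ^- 2
    = d%:R ^- 2 * \sum_(j <- [seq (n %/ d)%N | n <- [seq n <- s | d %| n]%N])
        j%:R ^- 2 :> R.
  rewrite big_map big_filter mulr_sumr [RHS]big_mkcond /=.
  apply: eq_bigr => n _; case: ifP => [/dvdnP[q ->]|_]; last by rewrite mul0r.
  by rewrite mulnK // mul1r natrM exprMn invfM mulrC.
have le1 : \sum_(j <- [seq (n %/ d)%N | n <- [seq n <- s | d %| n]%N]) j%:R ^- 2
    <= 2 / J%:R :> R.
  apply: le_trans (sum_inv_sqr_le R (\max_(n <- s) n).+1 J0).
  apply: ler_sum_subset => [||j]; last by rewrite invr_ge0 sqr_ge0.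
    rewrite map_inj_in_uniq ?filter_uniq // => x y.
    rewrite !mem_filter => /andP[dx _] /andP[dy _] xy.
    by rewrite -(divnK dx) -(divnK dy) xy.
  move=> j; rewrite filter_predT => /mapP[n]; rewrite mem_filter => /andP[dn ns] ->.
  rewrite mem_index_iota ltnS; apply/andP; split.
    have n0 : (0 < n)%N by apply: leq_trans N0 (sN _ ns).
    have Mn : (M <= n)%N by rewrite geq_max sN //= dvdn_leq.
    rewrite -ltnS ltn_divLR //; move: Mn; rewrite -{1}(divnK dn) mulSn; lia.
  by apply: leq_trans (leq_div _ _) _; rewrite (leq_bigmax_seq n).
apply: le_trans (ler_wpM2l _ le1) _; first by rewrite invr_ge0 sqr_ge0.
have -> : d%:R ^- 2 * (2 / J%:R) = 2 / (d%:R * (J * d)%:R) :> R.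
  by rewrite natrM; field; rewrite !pnatr_eq0 -!lt0n J0 d0.
rewrite ler_pM2l // lef_pV2 ?posrE ?(mulr_gt0 d0' M0) //.
  by rewrite ler_pM2l // ler_nat.
by rewrite mulr_gt0 // ltr0n muln_gt0 J0.
Qed.

(** The terms [d <= N] form a harmonic sum over [N ^ 2], giving [1 + ln N]; the terms [d > N] are
    [d ^- 3 <= N^-1 * d ^- 2], giving the other 2. *)
Lemma sum_inv_mul_max_sqr (R : realType) (N K : nat) : (0 < N)%N -> (N <= K)%N ->
  \sum_(1 <= d < K.+1) (d%:R * (maxn N d)%:R ^+ 2)^-1
    <= (3 + ln N%:R) / N%:R ^+ 2 :> R.
Proof.
move=> N0 NK; rewrite (@big_cat_nat _ _ _ N.+1) //=.
have N0' : 0 < N%:R :> R by rewrite ltr0n.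
have small : \sum_(1 <= d < N.+1) (d%:R * (maxn N d)%:R ^+ 2)^-1
    <= (1 + ln N%:R) / N%:R ^+ 2 :> R.
  rewrite -(ler_pM2r (exprn_gt0 2 N0')) divfK ?expf_neq0 ?gt_eqF //.
  apply: le_trans (harmonic_le_ln R N0).
  rewrite mulr_suml; apply: ler_sum_nat => d /andP[d0 dN].
  by rewrite (maxn_idPl _) // invfM divfK // expf_neq0 // gt_eqF.
have large : \sum_(N.+1 <= d < K.+1) (d%:R * (maxn N d)%:R ^+ 2)^-1
    <= 2 / N%:R ^+ 2 :> R.
  rewrite [2 / _](_ : _ = N%:R^-1 * (2 / N%:R)); last by field; rewrite gt_eqF.
  apply: (@le_trans _ _ (N%:R^-1 * \sum_(N.+1 <= d < K.+1) d%:R ^- 2)).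
    rewrite mulr_sumr; apply: ler_sum_nat => d /andP[Nd _].
    rewrite (maxn_idPr (ltnW Nd)) invfM ler_wpM2r ?invr_ge0 ?sqr_ge0 //.
    rewrite lef_pV2 ?posrE ?ltr0n ?ler_nat ?(ltnW Nd) //.
    exact: leq_ltn_trans Nd.
  apply: ler_wpM2l; first by rewrite invr_ge0 ltW.
  apply: le_trans (sum_inv_sqr_le R K.+1 (ltn0Sn N)) _.
  by rewrite ler_pM2l // lef_pV2 ?posrE ?ltr0n // ler_nat.
by apply: le_trans (lerD small large) _; rewrite -mulrDl; apply: ler_wpM2r;
  [rewrite invr_ge0 sqr_ge0 | lra].
Qed.

Lemma sum_gcd_le (R : realType) (s : seq nat) (N : nat) :
  uniq s -> (forall n, n \in s -> (N <= n)%N) -> (0 < N)%N ->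
  \sum_(n <- s) \sum_(k <- s) (gcdn n k)%:R * (n%:R ^- 2 * k%:R ^- 2)
    <= 4 * ((3 + ln N%:R) / N%:R ^+ 2) :> R.
Proof.
(* [K] bounds every gcd that occurs, and [N <= K] is required by [sum_inv_mul_max_sqr]. *)
move=> us sN N0; pose K := maxn N (\max_(n <- s) n).
have inv2_ge0 n : 0 <= n%:R ^- 2 :> R by rewrite invr_ge0 sqr_ge0.
(* gcd (n, k) is one of the terms of the sum of its divisors d. *)
pose B d : R := \sum_(n <- s) (d %| n)%:R * n%:R ^- 2.
apply: (@le_trans _ _ (\sum_(1 <= d < K.+1) d%:R * B d ^+ 2)).
  have -> : \sum_(1 <= d < K.+1) d%:R * B d ^+ 2 = \sum_(n <- s) \sum_(k <- s)
      (\sum_(1 <= d < K.+1) d%:R * ((d %| n)%:R * (d %| k)%:R))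
        * (n%:R ^- 2 * k%:R ^- 2).
    under eq_bigr => d _.
      rewrite expr2 mulr_suml mulr_sumr.
      under eq_bigr => n _ do rewrite !mulr_sumr.
      over.
    rewrite exchange_big /=; apply: eq_bigr => n _.
    rewrite exchange_big /=; apply: eq_bigr => k _.
    by rewrite mulr_suml; apply: eq_bigr => d _; ring.
  rewrite big_seq [leRHS]big_seq; apply: ler_sum => n ns.
  apply: ler_sum => k _; rewrite ler_wpM2r ?mulr_ge0 //.
  have n0 : (0 < n)%N by apply: leq_trans N0 (sN _ ns).
  have gK : gcdn n k \in index_iota 1 K.+1.
    rewrite mem_index_iota gcdn_gt0 n0 ltnS /= leq_max; apply/orP; right.
    apply: leq_trans (dvdn_leq n0 (dvdn_gcdl _ _)) _.
    by rewrite (leq_bigmax_seq n).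
  rewrite (big_rem _ gK) /= dvdn_gcdl dvdn_gcdr !mulr1 lerDl.
  by rewrite sumr_ge0 // => d _; rewrite -natrM -natrM ler0n.
apply: le_trans (ler_wpM2l _ (sum_inv_mul_max_sqr R N0 (leq_maxl N _ : (N <= K)%N))) => //.
rewrite mulr_sumr; apply: ler_sum_nat => d /andP[d0 _].
have d0' : 0 < d%:R :> R by rewrite ltr0n.
have M0 : 0 < (maxn N d)%:R :> R by rewrite ltr0n leq_max N0.
have Bd : B d <= 2 / (d%:R * (maxn N d)%:R) by apply: sum_inv_sqr_multiples.
have B0 : 0 <= B d by rewrite sumr_ge0 // => n _; rewrite mulr_ge0.
apply: (@le_trans _ _ (d%:R * (2 / (d%:R * (maxn N d)%:R)) ^+ 2)).
  by rewrite ler_wpM2l ?(ltW d0') // lerXn2r // nnegrE // (le_trans B0).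
by rewrite le_eqVlt; apply/orP; left; apply/eqP; field; rewrite !gt_eqF.
Qed.

(** The constant 3 is attained at [n = 3]. *)
Lemma inv_sub2_le (R : realType) (n : nat) : (3 <= n)%N ->
  (n - 2)%:R^-1 <= 3 / n%:R :> R.
Proof.
move=> n3; have n0 : 0 < n%:R :> R by rewrite ltr0n; lia.
have n2 : 0 < (n - 2)%:R :> R by rewrite ltr0n; lia.
rewrite ler_pdivlMr // mulrC ler_pdivrMr // -natrM ler_nat; lia.
Qed.

(** The function [g] of the overview, with the set of moduli as a sequence. *)
Definition shifted_divisor_sum (R : realType) (s : seq nat) (m : nat) : R :=
  \sum_(n <- s) (n - 2)%:R^-1 * (n %| m)%:R.

Lemma second_moment_le (R : realType) (s : seq nat) (N L : nat) :
  uniq s -> (forall n, n \in s -> (N <= n)%N) -> (3 <= N)%N ->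
  (0 < L)%N -> (forall n, n \in s -> (n %| L)%N) ->
  L%:R^-1 * \sum_(m < L) shifted_divisor_sum R s m ^+ 2
    <= 36 * ((3 + ln N%:R) / N%:R ^+ 2) :> R.
Proof.
move=> us sN N3 L0 sL; rewrite avg_dvd_sum_sqr //.
have N0 : (0 < N)%N by apply: leq_trans N3.
(* The factor 9 comes from replacing both [1 / (n - 2)] and [1 / (k - 2)] through [inv_sub2_le], the
   factor 4 from [sum_gcd_le]. *)
have -> : 36 = 9 * 4 :> R by ring.
rewrite -[leRHS]mulrA; apply: le_trans (ler_wpM2l _ (sum_gcd_le R us sN N0)) => //.
rewrite mulr_sumr big_seq [leRHS]big_seq; apply: ler_sum => n ns.
rewrite mulr_sumr big_seq [leRHS]big_seq; apply: ler_sum => k ks.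
have n3 := leq_trans N3 (sN _ ns); have k3 := leq_trans N3 (sN _ ks).
have n0 : n%:R != 0 :> R by rewrite pnatr_eq0; lia.
have k0 : k%:R != 0 :> R by rewrite pnatr_eq0; lia.
have lgE : (lcmn n k)%:R * (gcdn n k)%:R = n%:R * k%:R :> R.
  by rewrite -!natrM muln_lcm_gcd.
have l0 : (lcmn n k)%:R != 0 :> R by rewrite pnatr_eq0 -lt0n lcmn_gt0; lia.
have -> : 9 * ((gcdn n k)%:R * (n%:R ^- 2 * k%:R ^- 2))
    = (3 / n%:R) * (3 / k%:R) / (lcmn n k)%:R :> R.
  have -> : (gcdn n k)%:R = n%:R * k%:R / (lcmn n k)%:R :> R.
    by rewrite -lgE; field.
  by field; rewrite ?n0 ?k0 ?l0.
rewrite ler_wpM2r ?invr_ge0 //.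
by rewrite ler_pM ?invr_ge0 ?inv_sub2_le.
Qed.

(** * Moments of sigma_(-1/2) *)

Definition tau (n : nat) : nat := size (divisors n).

(** A divisor [d] of [a * b] is recovered as the product of [gcdn d a] and [d %/ gcdn d a]; the
    first divides [a], and the second divides [b] because it is coprime to [a %/ gcdn d a]. *)
Lemma tau_mul_le (a b : nat) : (0 < a)%N -> (0 < b)%N ->
  (tau (a * b) <= tau a * tau b)%N.
Proof.
move=> a0 b0; rewrite /tau -(size_allpairs muln); apply: uniq_leq_size => [|d].
  exact: divisors_uniq.
rewrite -dvdn_divisors ?muln_gt0 ?a0 // => dab.
have [d0|d0] := posnP d; first by move: dab; rewrite d0 dvd0n muln_eq0; lia.
have g0 : (0 < gcdn d a)%N by rewrite gcdn_gt0 d0.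
apply/allpairsP; exists (gcdn d a, d %/ gcdn d a)%N => /=.
rewrite -!dvdn_divisors // dvdn_gcdr mulnC divnK ?dvdn_gcdl //; split=> //.
have : (d %/ gcdn d a %| (a %/ gcdn d a) * b)%N.
  rewrite -(dvdn_pmul2r g0) divnK ?dvdn_gcdl //.
  by rewrite mulnAC divnK ?dvdn_gcdr.
rewrite Gauss_dvdr // /coprime -(eqn_pmul2r g0) mul1n muln_gcdl.
by rewrite !divnK ?dvdn_gcdl ?dvdn_gcdr.
Qed.

Lemma tau_leq (a b : nat) : (0 < b)%N -> (a %| b)%N -> (tau a <= tau b)%N.
Proof.
move=> b0 ab; apply: uniq_leq_size (divisors_uniq a) _ => d.
have a0 := dvdn_gt0 b0 ab.
by rewrite -!dvdn_divisors // => /dvdn_trans; apply.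
Qed.

Lemma sum_dvd_le_tau (R : realType) (s : seq nat) (q : nat) :
  uniq s -> (0 < q)%N -> \sum_(n <- s) (n %| q)%:R <= (tau q)%:R :> R.
Proof.
move=> us q0; rewrite -natr_sum ler_nat /tau -sum1_size.
have -> : (\sum_(n <- s) (n %| q) = \sum_(n <- [seq n <- s | n %| q]) 1)%N.
  by rewrite big_filter [RHS]big_mkcond; apply: eq_bigr => n _; case: (n %| q)%N.
rewrite !sum1_size; apply: uniq_leq_size; first exact: filter_uniq.
by move=> n; rewrite mem_filter -dvdn_divisors // => /andP[].
Qed.

Lemma sum_invrt3_le (R : realType) (X : nat) :
  \sum_(1 <= l < X) (l%:R * Num.sqrt l%:R)^-1 <= 3 :> R.
Proof.
case: X => [|[|X]]; [by rewrite big_geq|by rewrite big_geq|].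
(* Telescoping again, with equality at the single term [l = 1]. The step uses
   [(b - a) * (b + a) = 1] for consecutive square roots [a] and [b]. *)
suff : \sum_(1 <= l < X.+2) (l%:R * Num.sqrt l%:R)^-1
    <= 3 - 2 / Num.sqrt X.+1%:R :> R.
  by move=> /le_trans; apply; rewrite gerBl divr_ge0 ?sqrtr_ge0.
elim: X => [|X IH]; first by rewrite big_nat1 sqrtr1 mulr1 divr1 invr1; lra.
rewrite big_nat_recr //=; set S := \sum_(_ <= _ < _) _ in IH *.
move: IH; set a := Num.sqrt X.+1%:R; set b := Num.sqrt X.+2%:R => IH.
have a0 : 0 < a by rewrite sqrtr_gt0.
have b0 : 0 < b by rewrite sqrtr_gt0.
have a2 : a ^+ 2 = X.+1%:R by rewrite sqr_sqrtr.
have b2 : b ^+ 2 = X.+2%:R by rewrite sqr_sqrtr.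
have ab2 : b ^+ 2 = a ^+ 2 + 1 by rewrite a2 b2 natr1.
have ab : a <= b by rewrite ler_sqrt // ler_nat.
rewrite -b2.
suff : (b ^+ 2 * b)^-1 <= 2 / a - 2 / b by lra.
rewrite -subr_ge0.
have -> : 2 / a - 2 / b - (b ^+ 2 * b)^-1 = (2 * (b - a) * b ^+ 2 - a) / (a * b ^+ 3).
  by field; rewrite !gt_eqF.
rewrite divr_ge0 ?mulr_ge0 ?exprn_ge0 ?ltW //.
have : (b - a) * (b + a) = 1 by rewrite -[1](addKr (a ^+ 2)) -ab2; ring.
nra.
Qed.

(* Since l has [tau l] factorizations d * e, and [tau] is submultiplicative, the sum
   for j.+1 is at most the square of the sum for j. *)
Lemma sum_tau_bounded (R : realType) (j : nat) : exists2 K : R, 0 <= K &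
  forall X, \sum_(1 <= l < X) (tau l)%:R ^+ j / (l%:R * Num.sqrt l%:R) <= K.
Proof.
elim: j => [|j [K K0 IH]].
  exists 3 => // X; under eq_bigr => l _ do rewrite expr0 mul1r.
  exact: sum_invrt3_le.
exists (K ^+ 2) => [|X]; first exact: sqr_ge0.
pose f (l : nat) : R := (l%:R * Num.sqrt l%:R)^-1.
have f0 l : 0 <= f l by rewrite invr_ge0 mulr_ge0 ?sqrtr_ge0.
have fM a b : f (a * b)%N = f a * f b.
  by rewrite /f natrM sqrtrM // -invfM mulrACA.
pose F (l : nat) : R := (tau l)%:R ^+ j * f l.
have F0 l : 0 <= F l by rewrite mulr_ge0 ?exprn_ge0.
have FM a b : (0 < a)%N -> (0 < b)%N -> F (a * b)%N <= F a * F b.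
  move=> a0 b0; rewrite /F fM mulrACA ler_wpM2r ?mulr_ge0 //.
  by rewrite -exprMn lerXn2r ?nnegrE ?mulr_ge0 // -natrM ler_nat tau_mul_le.
have S0 : 0 <= \sum_(1 <= l < X) F l by rewrite sumr_ge0.
apply: (@le_trans _ _ ((\sum_(1 <= l < X) F l) ^+ 2)); last first.
  by rewrite lerXn2r ?nnegrE.
apply: (@le_trans _ _ (\sum_(1 <= l < X) \sum_(1 <= d < X) \sum_(1 <= e < X)
   (l == d * e)%N%:R * F l)).
  apply: ler_sum_nat => l /andP[l0 lX].
  rewrite exprS -mulrA -/(f l) -/(F l).
  under eq_bigr => d _ do rewrite -mulr_suml.
  rewrite -mulr_suml ler_wpM2r // /tau -sum1_size natr_sum.
  apply: (@le_trans _ _ (\sum_(d <- divisors l) \sum_(1 <= e < X) (l == d * e)%N%:R)).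
    rewrite big_seq [leRHS]big_seq; apply: ler_sum => d.
    rewrite -dvdn_divisors // => dl.
    have eX : (l %/ d)%N \in index_iota 1 X.
      rewrite mem_index_iota divn_gt0 ?(dvdn_gt0 l0 dl) // dvdn_leq //=.
      exact: leq_ltn_trans (leq_div _ _) lX.
    by rewrite (big_rem _ eX) /= mulnC divnK // eqxx lerDl sumr_ge0.
  apply: ler_sum_subset (divisors_uniq l) _ _ => d; last by rewrite sumr_ge0.
  rewrite filter_predT -dvdn_divisors // => dl.
  rewrite mem_index_iota (dvdn_gt0 l0 dl) /=.
  exact: leq_ltn_trans (dvdn_leq l0 dl) lX.
rewrite expr2 mulr_suml exchange_big /=; apply: ler_sum_nat => d /andP[d0 _].
rewrite mulr_sumr exchange_big /=; apply: ler_sum_nat => e /andP[e0 _].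
apply: le_trans (FM _ _ d0 e0).
(* Each pair [d, e] matches at most one [l], and none if the product leaves the range. *)
have [de|de] := boolP (d * e \in index_iota 1 X)%N; last first.
  rewrite big_seq big1 // => l lX; case: eqVneq => [lE|_]; last by rewrite mul0r.
  by rewrite -lE lX in de.
rewrite (bigD1_seq _ de (iota_uniq _ _)) /= eqxx mul1r big1 ?addr0 //.
by move=> l /negPf->; rewrite mul0r.
Qed.

(** The function [h] of the overview. Summing over the divisors of [L] keeps it meaningful at
    [m = 0]. *)
Definition sigma_half (R : realType) (L m : nat) : R :=
  \sum_(n <- divisors L) (n %| m)%:R / Num.sqrt n%:R.

Lemma sigma_half_ge1 (R : realType) (L m : nat) : 1 <= sigma_half R L m.
Proof.
rewrite /sigma_half (big_rem _ (divisor1 L)) /= dvd1n sqrtr1 divr1 lerDl.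
by rewrite sumr_ge0 // => n _; rewrite divr_ge0 ?sqrtr_ge0.
Qed.

(* A product of divisor sums is regrouped according to the lcm q of the two divisors;
   at most [tau q ^ 2] pairs have lcm q, whence the exponent [k.*2]. *)
Lemma sigma_half_exp_le (R : realType) (L m k : nat) : (0 < L)%N ->
  sigma_half R L m ^+ k
    <= \sum_(l <- divisors L) (l %| m)%:R * ((tau l)%:R ^+ k.*2 / Num.sqrt l%:R).
Proof.
move=> L0.
have isqrt_ge0 n : 0 <= (Num.sqrt n%:R)^-1 :> R by rewrite invr_ge0 sqrtr_ge0.
elim: k => [|k IH].
  rewrite (big_rem _ (divisor1 L)) /= dvd1n sqrtr1 !expr0 divr1 mulr1 lerDl.
  by rewrite sumr_ge0 // => n _; rewrite mulr_ge0 ?divr_ge0 ?sqrtr_ge0 ?exprn_ge0.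
rewrite exprS; apply: le_trans (ler_wpM2l _ IH) _.
  exact: le_trans ler01 (sigma_half_ge1 _ _ _).
pose F (q : nat) : R := (q %| m)%:R * ((tau q)%:R ^+ k.*2 / Num.sqrt q%:R).
have F0 q : 0 <= F q by rewrite !mulr_ge0 ?exprn_ge0.
apply: (@le_trans _ _ (\sum_(n <- divisors L) \sum_(l <- divisors L)
  \sum_(q <- divisors L) ((n %| q)%:R * (l %| q)%:R) * F q)).
  rewrite /sigma_half mulr_suml big_seq [leRHS]big_seq; apply: ler_sum => n.
  rewrite -dvdn_divisors // => nL.
  rewrite mulr_sumr big_seq [leRHS]big_seq; apply: ler_sum => l.
  rewrite -dvdn_divisors // => lL.
  have lcmL : lcmn n l \in divisors L by rewrite -dvdn_divisors // dvdn_lcm nL.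
  have n0 := dvdn_gt0 L0 nL; have l0 := dvdn_gt0 L0 lL.
  have q0 : (0 < lcmn n l)%N by rewrite lcmn_gt0 n0.
  rewrite (big_rem _ lcmL) /= dvdn_lcml dvdn_lcmr !mul1r.
  apply: ler_wpDr; first by rewrite sumr_ge0 // => q _; rewrite !mulr_ge0 ?exprn_ge0.
  rewrite /F dvdn_lcm -mulnb natrM.
  (* With [q] the lcm, [l] divides [q] gives [tau l <= tau q], and [q <= n * l] bounds
     [1 / sqrt (n * l)] by [1 / sqrt q]. *)
  rewrite [leLHS](_ : _ = ((n %| m)%:R * (l %| m)%:R) *
     ((tau l)%:R ^+ k.*2 * ((Num.sqrt n%:R)^-1 / Num.sqrt l%:R))); last by ring.
  rewrite ler_wpM2l ?mulr_ge0 // ler_pM ?mulr_ge0 ?exprn_ge0 //.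
    by rewrite lerXn2r ?nnegrE // ler_nat tau_leq // dvdn_lcmr.
  rewrite -invfM -sqrtrM // lef_pV2 ?posrE ?sqrtr_gt0 -?natrM ?ltr0n ?muln_gt0 ?n0 //.
  by rewrite ler_sqrt // ler_nat dvdn_leq ?muln_gt0 ?n0 // dvdn_lcm dvdn_mulr // dvdn_mull.
under eq_bigr => n _ do rewrite exchange_big /=.
rewrite exchange_big /= big_seq [leRHS]big_seq; apply: ler_sum => q.
rewrite -dvdn_divisors // => qL; have q0 := dvdn_gt0 L0 qL.
under eq_bigr => n _ do rewrite -mulr_suml -mulr_sumr.
rewrite -!mulr_suml doubleS !exprS /F.
rewrite [leRHS](_ : _ = (tau q)%:R * (tau q)%:R * F q); last by rewrite /F; ring.
rewrite ler_wpM2r // ler_pM ?sumr_ge0 // sum_dvd_le_tau // divisors_uniq //.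
Qed.

(** Averaging turns the condition that [l] divides [m] into a factor [1 / l]; the sum over divisors
    of [L] is then part of the convergent series of [sum_tau_bounded], whose bound does not depend
    on [L]. *)
Lemma sigma_half_moment_bounded (R : realType) (k : nat) : exists2 K : R, 0 <= K &
  forall L, (0 < L)%N -> L%:R^-1 * \sum_(m < L) sigma_half R L m ^+ k <= K.
Proof.
have [K K0 KP] := sum_tau_bounded R k.*2; exists K => // L L0.
have Li0 : 0 <= L%:R^-1 :> R by rewrite invr_ge0.
apply: (@le_trans _ _ (L%:R^-1 * \sum_(m < L) \sum_(l <- divisors L)
    (tau l)%:R ^+ k.*2 / Num.sqrt l%:R * (l %| m)%:R)).
  rewrite ler_wpM2l //; apply: ler_sum => m _.
  apply: le_trans (sigma_half_exp_le R m k L0) _.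
  by apply: ler_sum => l _; rewrite mulrC.
rewrite avg_dvd_sum // => [|l]; last by rewrite -dvdn_divisors.
apply: le_trans (KP L.+1).
under eq_bigr => l _ do rewrite -mulrA -invfM mulrC [_ * l%:R]mulrC mulrC.
apply: ler_sum_subset (divisors_uniq L) _ _ => l.
  rewrite filter_predT -dvdn_divisors // => lL.
  by rewrite mem_index_iota (dvdn_gt0 L0 lL) ltnS dvdn_leq.
by rewrite divr_ge0 ?exprn_ge0 ?mulr_ge0 ?sqrtr_ge0.
Qed.

(** * The variance bound *)

(** Iterating [expR x <= 1 + x * expR x] four times gives the cubic Taylor polynomial without
    factorials plus [x ^+ 4 * expR x]; the cubic term is absorbed by its neighbours. *)
Lemma expR_le_quartic (R : realType) (x : R) : 0 <= x ->
  expR x <= 1 + x + 2 * x ^+ 2 + 2 * (x ^+ 4 * expR x).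
Proof.
move=> x0; have e1 : 1 <= expR x by apply: le_trans (expR_ge1Dx x); rewrite lerDl.
have step : expR x <= 1 + x * expR x.
  have := expR_ge1Dx (- x); rewrite -(ler_pM2l (expR_gt0 x)) expRxMexpNx_1.
  lra.
have step2 := ler_wpM2l x0 step.
have step3 := ler_wpM2l x0 step2.
have step4 := ler_wpM2l x0 step3.
have c : x ^+ 3 <= x ^+ 2 + x ^+ 4.
  have : 0 <= x ^+ 2 * ((x - 2^-1) ^+ 2 + 3 / 4).
    by rewrite mulr_ge0 ?sqr_ge0 // addr_ge0 ?sqr_ge0.
  rewrite (_ : _ * _ = x ^+ 2 + x ^+ 4 - x ^+ 3); last by field.
  by rewrite subr_ge0.
have d : x ^+ 4 <= x ^+ 4 * expR x by rewrite ler_peMr // exprn_ge0.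
have e3 : x * (x * (x * (1 + x * expR x))) = x ^+ 3 + x ^+ 4 * expR x by ring.
have e2 : x * (x * (1 + x * expR x)) = x ^+ 2 + x * (x * (x * expR x)) by ring.
have e1' : x * (1 + x * expR x) = x + x * (x * expR x) by ring.
lra.
Qed.

Lemma prod_1D_le_expR (R : realType) (I : eqType) (s : seq I) (x : I -> R) :
  (forall i, i \in s -> 0 <= 1 + x i) ->
  \prod_(i <- s) (1 + x i) <= expR (\sum_(i <- s) x i).
Proof.
move=> x0; rewrite expR_sum big_seq [leRHS]big_seq; apply: ler_prod => i si.
by rewrite x0 //= expR_ge1Dx.
Qed.

(** For [n >= N], [1 / (n - 2) <= 3 / n <= 3 / (sqrt N * sqrt n)]. *)
Lemma shifted_divisor_sum_le_sigma_half (R : realType) (s : seq nat) (N L m : nat) :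
  uniq s -> (forall n, n \in s -> (N <= n)%N) -> (3 <= N)%N ->
  (0 < L)%N -> (forall n, n \in s -> (n %| L)%N) ->
  shifted_divisor_sum R s m
    <= 3 / Num.sqrt N%:R * sigma_half R L m.
Proof.
move=> us sN N3 L0 sL.
apply: (@le_trans _ _ (3 / Num.sqrt N%:R *
    \sum_(n <- s) (n %| m)%:R / Num.sqrt n%:R)); last first.
  rewrite ler_wpM2l ?divr_ge0 ?sqrtr_ge0 //.
  apply: ler_sum_subset us _ _ => n; last by rewrite divr_ge0 ?sqrtr_ge0.
  by rewrite filter_predT -dvdn_divisors //; exact: sL.
rewrite /shifted_divisor_sum mulr_sumr big_seq [leRHS]big_seq.
apply: ler_sum => n ns; have Nn := sN _ ns; have n3 := leq_trans N3 Nn.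
rewrite mulrCA mulrC ler_wpM2l //.
apply: le_trans (inv_sub2_le R n3) _.
rewrite -mulrA -invfM ler_wpM2l // lef_pV2 ?posrE ?mulr_gt0 ?sqrtr_gt0 ?ltr0n; try lia.
by rewrite -[leRHS]sqr_sqrtr // expr2 ler_wpM2r ?sqrtr_ge0 // ler_sqrt ?ler_nat.
Qed.

(* The terms n <= D of the sum contribute at most 3 (1 + ln D), and those with n > D
   at most 3 D^(-1/2) h; take D close to h^2. *)
Lemma expR_shifted_divisor_sum_le (R : realType) (s : seq nat) (L m : nat) :
  uniq s -> (forall n, n \in s -> (3 <= n)%N) ->
  (0 < L)%N -> (forall n, n \in s -> (n %| L)%N) ->
  expR (shifted_divisor_sum R s m)
    <= 8 * expR 6 * sigma_half R L m ^+ 6.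
Proof.
move=> us s3 L0 sL; set H := sigma_half R L m.
have H1 : 1 <= H by exact: sigma_half_ge1.
have H0 : 0 <= H by lra.
have H21 : 1 <= H ^+ 2 by rewrite exprn_ege1.
(* Since [H >= 1], [D] lies between [H ^+ 2] and [2 * H ^+ 2]: the lower bound makes the tail at
   most 3, the upper one gives [D ^+ 3 <= 8 * H ^+ 6]. *)
pose D := (Num.truncn (H ^+ 2)).+1.
have HD : H ^+ 2 <= D%:R by rewrite ltW // truncnS_gt.
have DH : D%:R <= 2 * H ^+ 2.
  rewrite /D -natr1; have := truncn_le (H ^+ 2); rewrite sqr_ge0; lra.
have D0 : 0 < D%:R :> R by [].
have sD0 : 0 < Num.sqrt D%:R :> R by rewrite sqrtr_gt0.
have HsD : H <= Num.sqrt D%:R by rewrite -[H]ger0_norm // -sqrtr_sqr ler_sqrt.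
apply: (@le_trans _ _ (expR (6 + 3 * ln D%:R))); last first.
  rewrite expRD expRM_natl lnK ?posrE //.
  apply: (@le_trans _ _ (expR 6 * (2 * H ^+ 2) ^+ 3)).
    by rewrite ler_wpM2l ?expR_ge0 // lerXn2r ?nnegrE ?mulr_ge0 ?sqr_ge0.
  by rewrite le_eqVlt; apply/orP; left; apply/eqP; ring.
rewrite ler_expR /shifted_divisor_sum.
apply: (@le_trans _ _ (3 * \sum_(n <- s | (n < D.+1)%N) n%:R^-1
    + 3 / Num.sqrt D%:R * \sum_(n <- s) (n %| m)%:R / Num.sqrt n%:R)).
  rewrite !mulr_sumr [X in _ <= X + _]big_mkcond -big_split /= big_seq [leRHS]big_seq.
  apply: ler_sum => n ns; have n3 := s3 _ ns.
  have n0 : 0 < n%:R :> R by rewrite ltr0n; lia.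
  have le3 := inv_sub2_le R n3.
  have i0 : 0 <= (n - 2)%:R^-1 :> R by rewrite invr_ge0.
  case: ltnP => [nD|Dn].
    apply: ler_wpDr; first by rewrite !(mulr_ge0, divr_ge0, sqrtr_ge0).
    by case: (n %| m)%N; rewrite ?mulr1 ?mulr0 // divr_ge0 // ltW.
  rewrite add0r mulrCA mulrC ler_wpM2l //.
  apply: le_trans le3 _.
  rewrite -mulrA -invfM ler_wpM2l // lef_pV2 ?posrE ?mulr_gt0 ?sqrtr_gt0 //.
  rewrite -[leRHS]sqr_sqrtr ?(ltW n0) // expr2 ler_wpM2r ?sqrtr_ge0 //.
  by rewrite ler_sqrt ?ler_nat // ltnW.
have part1 : \sum_(n <- s | (n < D.+1)%N) n%:R^-1 <= 1 + ln D%:R :> R.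
  apply: le_trans (harmonic_le_ln R (ltn0Sn _)).
  apply: ler_sum_subset us _ _ => n; last by rewrite invr_ge0.
  by rewrite mem_filter => /andP[nD /s3 n3]; rewrite mem_index_iota nD; lia.
have part2 : \sum_(n <- s) (n %| m)%:R / Num.sqrt n%:R <= H.
  apply: ler_sum_subset us _ _ => n; last by rewrite divr_ge0 ?sqrtr_ge0.
  by rewrite filter_predT -dvdn_divisors //; exact: sL.
have : 3 / Num.sqrt D%:R * \sum_(n <- s) (n %| m)%:R / Num.sqrt n%:R <= 3 :> R.
  rewrite -mulrA ler_piMr // mulrC ler_pdivrMr // mul1r.
  exact: le_trans part2 HsD.
lra.
Qed.

Lemma quartic_moment_le (R : realType) : exists2 K : R, 0 <= K &
  forall (s : seq nat) (N L : nat),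
  uniq s -> (forall n, n \in s -> (N <= n)%N) -> (3 <= N)%N ->
  (0 < L)%N -> (forall n, n \in s -> (n %| L)%N) ->
  L%:R^-1 * \sum_(m < L) shifted_divisor_sum R s m ^+ 4
      * expR (shifted_divisor_sum R s m) <= K / N%:R ^+ 2.
Proof.
(* The exponent is 4 from [g ^+ 4] plus 6 from the bound on [expR g]. *)
have [K K0 KP] := sigma_half_moment_bounded R 10.
pose c : R := 3 ^+ 4 * (8 * expR 6).
have c0 : 0 <= c by rewrite !mulr_ge0 ?expR_ge0.
exists (c * K) => [|s N L us sN N3 L0 sL]; first exact: mulr_ge0.
set g := shifted_divisor_sum R s.
have N0 : 0 < N%:R :> R by rewrite ltr0n; lia.
have Ni0 : 0 <= N%:R ^- 2 :> R by rewrite invr_ge0 sqr_ge0.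
apply: (@le_trans _ _ (c / N%:R ^+ 2
    * (L%:R^-1 * \sum_(m < L) sigma_half R L m ^+ 10))); last first.
  by rewrite [leRHS]mulrAC ler_wpM2l ?KP // mulr_ge0.
rewrite mulrCA ler_wpM2l ?invr_ge0 // mulr_sumr; apply: ler_sum => m _.
have g0 : 0 <= g m.
  by rewrite /g /shifted_divisor_sum sumr_ge0 // => n _; rewrite mulr_ge0 ?invr_ge0.
have le1 : g m ^+ 4 <= (3 / Num.sqrt N%:R * sigma_half R L m) ^+ 4.
  have le := shifted_divisor_sum_le_sigma_half R m us sN N3 L0 sL.
  by rewrite lerXn2r // nnegrE // (le_trans g0).
have le2 := expR_shifted_divisor_sum_le R m us (fun n ns => leq_trans N3 (sN n ns)) L0 sL.
apply: le_trans (ler_pM (exprn_ge0 4 g0) (expR_ge0 _) le1 le2) _.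
have sN0 : Num.sqrt N%:R != 0 :> R by rewrite gt_eqF // sqrtr_gt0.
rewrite -[N%:R in leRHS]sqr_sqrtr ?(ltW N0) // /c.
move: (Num.sqrt N%:R) (sigma_half R L m) (expR 6) sN0 => r h e r0.
by rewrite le_eqVlt; apply/orP; left; apply/eqP; field.
Qed.

Lemma avg_pair_prod_le (R : realType) (s : seq nat) (L : nat) :
  uniq s -> (forall n, n \in s -> (3 <= n)%N) ->
  (0 < L)%N -> (forall n, n \in s -> (n %| L)%N) ->
  L%:R^-1 * \sum_(m < L) \prod_(n <- s) ((n - 2 + (n %| m))%:R / n%:R)
    <= (\prod_(n <- s) (1 - n%:R^-1)) ^+ 2
       * (1 + 3 * (L%:R^-1 * \sum_(m < L) shifted_divisor_sum R s m ^+ 2)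
            + 2 * (L%:R^-1 * \sum_(m < L) shifted_divisor_sum R s m ^+ 4
                                  * expR (shifted_divisor_sum R s m))).
Proof.
move=> us s3 L0 sL; set g := shifted_divisor_sum R s; set a := \prod_(n <- s) _.
set M2 := L%:R^-1 * \sum_(m < L) g m ^+ 2; set M4 := L%:R^-1 * \sum_(m < L) g m ^+ 4 * expR (g m).
have Li0 : 0 <= L%:R^-1 :> R by rewrite invr_ge0.
have Ln0 : L%:R != 0 :> R by rewrite pnatr_eq0 -lt0n.
(* With [x = n - 2] the truncated subtraction becomes a field expression with positive
   denominators. *)
have sub_inv n : n \in s -> exists2 x : R, 1 <= x & n%:R = x + 2 /\ (n - 2)%:R = x.
  move=> /s3 n3; exists (n - 2)%:R; first by rewrite ler1n; lia.
  by split=> //; rewrite -natrD subnK //; lia.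
pose Q : R := \prod_(n <- s) (1 - (n%:R - 1) ^- 2).
pose S : R := \sum_(n <- s) (n%:R - 1) ^- 2.
have g0 m : 0 <= g m.
  by rewrite /g /shifted_divisor_sum sumr_ge0 // => n _; rewrite mulr_ge0 ?invr_ge0.
have fact m : \prod_(n <- s) ((n - 2 + (n %| m))%:R / n%:R)
    = a ^+ 2 * Q * \prod_(n <- s) (1 + (n - 2)%:R^-1 * (n %| m)%:R) :> R.
  rewrite expr2 /a /Q -!big_split /= big_seq [RHS]big_seq; apply: eq_bigr => n ns.
  have [x x1 [nE n2E]] := sub_inv _ ns.
  by rewrite natrD nE n2E; field; rewrite !gt_eqF //; lra.
have q01 n : n \in s -> 0 <= 1 - (n%:R - 1 : R) ^- 2 <= 1.
  move=> ns; have [x x1 [-> _]] := sub_inv _ ns.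
  have y1 : 1 <= (x + 2 - 1) ^+ 2 by rewrite exprn_ege1 //; lra.
  rewrite subr_ge0 invf_le1 ?y1 ?gerBl ?invr_ge0 ?sqr_ge0 //.
  exact: lt_le_trans y1.
have Q0 : 0 <= Q by rewrite /Q big_seq prodr_ge0 // => n /q01/andP[].
have Q1 : Q <= 1 by rewrite /Q big_seq Num.Theory.prodr_ile1 // => n /q01.
have S0 : 0 <= S by rewrite sumr_ge0 // => n _; rewrite invr_ge0 sqr_ge0.
(* [Q <= expR (- S)] and [1 + S <= expR S]: this is how the factor [Q] cancels the mean of [g]. *)
have QS : Q * (1 + S) <= 1.
  have QeS : Q <= expR (- S).
    rewrite /S -sumrN; apply: prod_1D_le_expR => n /q01/andP[] //.
  have S1 : 0 <= 1 + S by rewrite addr_ge0.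
  apply: le_trans (ler_pM Q0 S1 QeS (expR_ge1Dx S)) _.
  by rewrite mulrC expRxMexpNx_1.
have M40 : 0 <= M4.
  by rewrite mulr_ge0 // sumr_ge0 // => m _; rewrite mulr_ge0 ?exprn_ge0 ?expR_ge0.
have M20 : 0 <= M2 by rewrite mulr_ge0 // sumr_ge0 // => m _; rewrite sqr_ge0.
have mean : L%:R^-1 * \sum_(m < L) g m <= S + M2.
  rewrite /M2 /g /shifted_divisor_sum avg_dvd_sum // avg_dvd_sum_sqr // /S -big_split /=.
  rewrite big_seq [leRHS]big_seq; apply: ler_sum => n ns.
  rewrite (big_rem _ ns) /= addrA.
  (* [avg g - S] is already dominated by the diagonal terms of [avg g^2]. *)
  apply: ler_wpDr; first by rewrite sumr_ge0 // => k _; rewrite !mulr_ge0 ?invr_ge0.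
  have -> : lcmn n n = n by rewrite /lcmn gcdnn mulnK // (leq_trans _ (s3 _ ns)).
  have [x x1 [-> ->]] := sub_inv _ ns.
  rewrite -subr_ge0.
  have -> : (x + 2 - 1) ^- 2 + x^-1 * x^-1 / (x + 2) - x^-1 / (x + 2)
      = (x ^+ 2 + x + 1) / (x ^+ 2 * (x + 2) * (x + 1) ^+ 2).
    by field; rewrite !gt_eqF //; lra.
  by rewrite divr_ge0 ?mulr_ge0 ?addr_ge0 ?sqr_ge0 //; lra.
under eq_bigr => m _ do rewrite fact.
rewrite -mulr_sumr mulrCA -mulrA ler_wpM2l ?sqr_ge0 // {fact}.
(* Of the three copies of [M2], two come from the quadratic term of [expR_le_quartic] and one from
   [mean]. *)
have le : L%:R^-1 * \sum_(m < L) \prod_(n <- s) (1 + (n - 2)%:R^-1 * (n %| m)%:R)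
    <= 1 + S + 3 * M2 + 2 * M4.
  apply: (@le_trans _ _ (L%:R^-1 * \sum_(m < L)
      (1 + g m + 2 * g m ^+ 2 + 2 * (g m ^+ 4 * expR (g m))))).
    rewrite ler_wpM2l //; apply: ler_sum => m _.
    apply: le_trans (expR_le_quartic (g0 m)).
    by apply: prod_1D_le_expR => n _; rewrite addr_ge0 ?mulr_ge0 ?invr_ge0.
  rewrite !big_split /= -!mulr_sumr sumr_const card_ord !mulrDr.
  rewrite mulVf // !(mulrCA L%:R^-1 2) -/M2 -/M4; lra.
have := ler_wpM2l Q0 le.
have Q2 : Q * (3 * M2 + 2 * M4) <= 3 * M2 + 2 * M4 by rewrite ler_piMl //; lra.
lra.
Qed.

Lemma half_le_ln (R : realType) (N : nat) : (3 <= N)%N -> 2^-1 <= ln N%:R :> R.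
Proof.
move=> N3; apply: (@le_trans _ _ (ln 3)); last by rewrite ler_ln ?posrE ?ltr0n ?ler_nat //; lia.
(* [ln (1 / 3) <= - 2 / 3] gives even [ln 3 >= 2 / 3]. *)
have := @le_ln1Dx R (- (2 / 3)); rewrite (_ : 1 - 2 / 3 = 3^-1); last by field.
rewrite lnV ?posrE //; lra.
Qed.

Theorem theorem7 (R : realType) :
  exists A : R, 0 < A /\
    forall (T : {fset nat}) (N : nat),
      (3 <= N)%N -> N \in T -> (forall n : nat, n \in T -> (N <= n)%N) ->
      (W T)%:R^-1 * (\sum_(C <- systems T) `|delta R C - alpha R T| ^+ 2)
        <= A * ((alpha R T) ^+ 2 * ln (N%:R : R) / N%:R ^+ 2).
Proof.
have [K K0 KP] := quartic_moment_le R.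
(* The bound found is [108 * (3 + ln N) + 2 * K]; as [1 <= 2 * ln N], it is at most
   [(108 * 7 + 4 * K) * ln N]. *)
exists (756 + 4 * K); split=> [|T N N3 _ TN]; first by lra.
have T3 n : n \in T -> (3 <= n)%N by move=> /TN; apply: leq_trans.
have [L0 TL] : (0 < \prod_(n <- T) n)%N /\ forall n, n \in T -> (n %| \prod_(n <- T) n)%N.
  by apply: prod_common_multiple => n /T3; apply: leq_trans.
move: (\prod_(n <- T) n)%N L0 TL => L L0 TL.
rewrite (variance_delta R (fun n nT => ltnW (T3 n nT)) L0 TL).
have uT : uniq T := fset_uniq T.
have := avg_pair_prod_le R uT T3 L0 TL.
have := second_moment_le R uT TN N3 L0 TL.
have := KP T N L uT TN N3 L0 TL.
rewrite -/(alpha R T).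
set M4 := L%:R^-1 * \sum_(m < L) _ ^+ 4 * _; set M2 := L%:R^-1 * \sum_(m < L) _ ^+ 2.
set E := L%:R^-1 * _; set a := alpha R T ^+ 2 => M4le M2le Ele.
clearbody M4 M2 E.
have a0 : 0 <= a by exact: sqr_ge0.
have Ni0 : 0 <= N%:R ^- 2 :> R by rewrite invr_ge0 sqr_ge0.
(* The leading 1 in the bound on [E] cancels against the subtracted square of [alpha]. *)
apply: (@le_trans _ _ (a * (3 * M2 + 2 * M4))); first by lra.
rewrite -[a * _ / _]mulrA [leRHS]mulrCA ler_wpM2l // [leRHS]mulrA.
have lnN := half_le_ln R N3.
apply: (@le_trans _ _ ((108 * (3 + ln N%:R) + 2 * K) * N%:R ^- 2)).
  rewrite [leRHS](_ : _ = 3 * (36 * ((3 + ln N%:R) / N%:R ^+ 2))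
    + 2 * (K / N%:R ^+ 2)); last by ring.
  by apply: lerD; apply: ler_wpM2l.
rewrite ler_wpM2r //.
have : K <= 2 * (K * ln N%:R) by have := ler_wpM2l K0 lnN; lra.
lra.
Qed.
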